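(* Let $H$ be a real Hilbert space of functions over $\Omega$. Suppose that the boundary value problem (P) admits a lifting $g\in H$ of its boundary data, that there exists $u^{(0)}\in H$ with $\mathcal{L}u^{(0)}=f$ in $\Omega$ and $\mathcal{B}_0u^{(0)}=0$, that the single-object exterior-interior transmission problems (T$_i$), $i\in\{1,\dots,N\}$, are well-posed in $H$ for any $u\in H$, and that the projection operators $P_{V_i}$, $i\in\{1,\dots,N\}$, are orthogonal. Then the sequence of approximations $(u^{(k)})_{k\in\mathbb{N}}$ generated by the sequential form of the method of reflections converges in the norm of $H$ to the solution $u^*=P_Vg+P_Mu^{(0)}$.
   Context: **Domain and problem.** $\Omega\subset\mathbb{R}^d$ is a simply connected regular open set; $O_1,\dots,O_N\subset\Omega$ are bounded simply connected open sets (''objects'') with smooth boundaries and pairwise disjoint closures. $\mathcal{L}$ is a linear differential operator acting on functions defined in $\Omega$; for $1\le j\le N$, $\mathcal{B}_j$ is a linear (possibly non-local) boundary operator on $\partial O_j$; $\mathcal{B}_0$ is a linear operator encoding a homogeneous condition on $\partial\Omega$ and/or at infinity. Given $f$ on $\Omega$ and $b_j$ on $\partial O_j$, problem (P) is: find $u$ with $\mathcal{L}u=f$ in $\Omega\setminus\cup_{j=1}^N\overline{O_j}$, $\mathcal{B}_ju=b_j$ for $j=1,\dots,N$, and $\mathcal{B}_0u=0$. It is assumed well-posed. A lifting of the boundary data is a function $g$ on $\Omega$ with $\mathcal{B}_jg=b_j$, $j=1,\dots,N$, and $\mathcal{B}_0g=0$. **Projections.** For $u\in H$ and $i\in\{1,\dots,N\}$,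 problem (T$_i$) is: find $w\in H$ with $\mathcal{L}w=\mathcal{L}u$ in $\Omega\setminus\overline{O_i}$, $\mathcal{B}_iw=0$, $\mathcal{B}_0w=0$, $\mathcal{L}w=0$ in $O_i$, together with chosen linear transmission conditions across $\partial O_i$ (depending on $\mathcal{L}$) making the problem uniquely solvable with continuous dependence on $u$. The map $P_{M_i}:u\mapsto w$ is a continuous linear projection of $H$, with closed range $M_i$; $P_{V_i}=Id_H-P_{M_i}$, with closed range $V_i$, so $H=V_i\oplus M_i$. Similarly, $P_M:u\mapsto w$ is the continuous linear projection defined by the multiple-object problem, assumed well-posed in $H$: $\mathcal{L}w=\mathcal{L}u$ in $\Omega\setminus\cup_j\overline{O_j}$, $\mathcal{B}_jw=0$ for $j=1,\dots,N$, $\mathcal{B}_0w=0$, $\mathcal{L}w=0$ in $\cup_jO_j$, with the same kind of transmission conditions across every $\partial O_j$. Its range is $M=\cap_{j=1}^NM_j$; $P_V=Id_H-P_M$ has range $V$. In the orthogonal setting considered here, $V_i=M_i^\perp$ and $V=M^\perp$. The solution of (P) is the restriction to $\Omega\setminus\cup_j\overline{O_j}$ of $u^*=P_Vg+P_Mu^{(0)}$, and this extension of the solution to $\Omega$ is also denoted $u^*$. **Sequential form of the method of reflections.** Starting from $u^{(0)}$, the reflections $u_i^{(k)}$ satisfy $\mathcal{L}u_i^{(k)}=0$ in $\Omega\setminus\overline{O_i}$, $\mathcal{B}_0u_i^{(k)}=0$, and $\mathcal{B}_iu_i^{(1)}=b_i-\mathcal{B}_i\bigl(u^{(0)}+\sum_{j=1}^{i-1}u_j^{(1)}\bigr)$,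 $\mathcal{B}_iu_i^{(k+1)}=-\mathcal{B}_i\bigl(\sum_{j=1}^{i-1}u_j^{(k+1)}+\sum_{j=i+1}^Nu_j^{(k)}\bigr)$ for $k\ge1$. Extended to all of $\Omega$ as elements of $H$ (same notation), they are $$u_i^{(1)}=-P_{V_i}\Bigl(u^{(0)}+\sum_{j=1}^{i-1}u_j^{(1)}-g\Bigr),\qquad u_i^{(k+1)}=-P_{V_i}\Bigl(\sum_{j=1}^{i-1}u_j^{(k+1)}+\sum_{j=i+1}^Nu_j^{(k)}\Bigr)\ (k\ge1).$$ The approximations are $u^{(k+1)}=u^{(k)}+\sum_{i=1}^Nu_i^{(k+1)}$, $k\in\mathbb{N}$. *)

(* Defs.v *)
From HB Require Import structures.
From mathcomp Require Import all_boot all_order all_algebra.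
From mathcomp Require Import sesquilinear.
From mathcomp Require Import all_classical all_reals all_analysis.

Set Implicit Arguments.
Unset Strict Implicit.
Unset Printing Implicit Defensive.

Import Order.TTheory GRing.Theory Num.Theory.
Import numFieldNormedType.Exports.

Local Open Scope classical_set_scope.
Local Open Scope ring_scope.

Definition frontier (T : topologicalType) (A : set T) : set T :=
  closure A `\` interior A.

(* A path is the restriction to [0, 1] of a map defined on R, and a based
   homotopy the restriction to [0, 1] x [0, 1] of a map defined on R * R. *)
Definition simply_connected (R : realType) (T : topologicalType) (A : set T) :=
  (forall x y, A x -> A y -> exists c : R -> T,
     [/\ {within `[0, 1], continuous c}, c @` `[0, 1] `<=` A,
         c 0 = x & c 1 = y]) /\
  (forall c : R -> T,
     {within `[0, 1], continuous c} -> c @` `[0, 1] `<=` A -> c 0 = c 1 ->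
     exists h : R * R -> T,
       [/\ {within `[0, 1] `*` `[0, 1], continuous h},
           h @` (`[0, 1] `*` `[0, 1]) `<=` A,
           (forall t, 0 <= t <= 1 -> h (0, t) = c t),
           (forall t, 0 <= t <= 1 -> h (1, t) = c 0) &
           (forall s, 0 <= s <= 1 -> h (s, 0) = c 0 /\ h (s, 1) = c 0)]).

Section calculus.
Context {R : realType} {d : nat}.
Local Notation Rd := 'rV[R]_d.

Fixpoint partials (s : seq 'I_d) (f : Rd -> R) : Rd -> R :=
  if s is i :: s' then 'D_(delta_mx 0 i) (partials s' f) else f.

Definition smooth (f : Rd -> R) := forall s : seq 'I_d,
  continuous (partials s f) /\
  forall (x : Rd) (i : 'I_d), derivable (partials s f) x (delta_mx 0 i).

(* A is locally the sublevel set of a smooth function without critical point,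
   hence lies on one side of its boundary, a smooth hypersurface. *)
Definition smooth_boundary (A : set Rd) := forall x, frontier A x ->
  exists (U : set Rd) (rho : Rd -> R),
    [/\ open U, U x, smooth rho,
        (exists i, partials [:: i] rho x != 0) &
        forall y, U y -> (A y <-> rho y < 0)].

Definition supp (phi : Rd -> R) : set Rd := closure [set x | phi x != 0].

Definition test_function (U : set Rd) (phi : Rd -> R) :=
  [/\ smooth phi, compact (supp phi) & supp phi `<=` U].

(* R^p-valued distributions on the open set Omega: only the values on test
   functions of Omega are meaningful. *)
Definition is_distribution (p : nat) (Omega : set Rd) (T : (Rd -> R) -> 'rV[R]_p) :=
  (forall (a : R) phi psi, test_function Omega phi -> test_function Omega psi ->
     T (a *: phi + psi) = a *: T phi + T psi) /\
  (forall K, compact K -> K `<=` Omega -> exists (C : R) (m : nat),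
     forall phi (M : R), test_function K phi ->
       (forall s x, (size s <= m)%N -> `|partials s phi x| <= M) ->
       `|T phi| <= C * M).

Definition eq_distr_in (p : nat) (U : set Rd) (S T : (Rd -> R) -> 'rV[R]_p) :=
  forall phi, test_function U phi -> S phi = T phi.

End calculus.

Definition borel (R : realType) (d : nat) :=
  g_sigma_algebraType (@open 'rV[R]_d).

Section lebesgue.
Context {R : realType} {d : nat}.
Local Notation Rd := 'rV[R]_d.
Variable lam : {measure set (borel R d) -> \bar R}.

(* This characterizes the Lebesgue measure among Borel measures on R^d. *)
Definition is_lebesgue_measure := forall a b : Rd,
  (forall i, a 0 i <= b 0 i) ->
  lam [set x : Rd | forall i, a 0 i <= x 0 i <= b 0 i] =
  (\prod_i (b 0 i - a 0 i))%:E.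

Definition loc_integrable (Omega : set Rd) (v : Rd -> R) :=
  forall K : set Rd, compact K -> K `<=` Omega ->
    lam.-integrable K (EFin \o v).

Definition weak_derivative (Omega : set Rd) (s : seq 'I_d) (v w : Rd -> R) :=
  [/\ loc_integrable Omega v, loc_integrable Omega w &
      forall phi, test_function Omega phi ->
        \int[lam]_(x in Omega) (w x * phi x) =
        (-1) ^+ size s * \int[lam]_(x in Omega) (v x * partials s phi x)].

End lebesgue.

Definition hilbert_norm (R : realType) (H : completeNormedModType R)
    (dot : {dot H for (idfun : R -> R)}) :=
  forall u : H, `|u| ^+ 2 = dot u u.

Definition orthogonal_projection (R : realType) (H : completeNormedModType R)
    (dot : {dot H for (idfun : R -> R)}) (P : H -> H) :=
  [/\ linear P, (forall u, P (P u) = P u) &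
      forall u v, dot (P u) (v - P v) = 0].

Section function_space.
Context {R : realType} {d q : nat} (H : completeNormedModType R).
Local Notation Rd := 'rV[R]_d.
Variables (lam : {measure set (borel R d) -> \bar R}) (Omega : set Rd).
Variable fn : H -> Rd -> 'rV[R]_q.

(* H is a space of R^q-valued functions over Omega, identified when they agree
   almost everywhere; fn chooses representatives. *)
Definition function_space :=
  (forall (a : R) (u v : H),
     ae_eq lam Omega (fn (a *: u + v)) (fun x => a *: fn u x + fn v x)) /\
  (forall u v : H, ae_eq lam Omega (fn u) (fn v) -> u = v).

(* Systems of p equations in q unknowns, in the sense of distributions:
     (L u)_k = sum_(l | eqn l = k)
                 (-1)^|beta l| D^(beta l) (a l * D^(alpha l) u_(unk l)),
   the signs being absorbed in the coefficients a l. With every beta l empty,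
   this is a differential operator in non-divergence form; the general form
   also covers div (sigma grad u) with a nonsmooth sigma. *)
Definition differential_operator (p : nat)
    (L : H -> (Rd -> R) -> 'rV[R]_p) :=
  (forall u, is_distribution Omega (L u)) /\
  exists (m : nat) (alpha beta : 'I_m -> seq 'I_d)
         (unk : 'I_m -> 'I_q) (eqn : 'I_m -> 'I_p) (a : 'I_m -> Rd -> R),
    forall u, exists w : 'I_m -> Rd -> R,
      (forall l, weak_derivative lam Omega (alpha l)
                   (fun x => fn u x 0 (unk l)) (w l) /\
                 loc_integrable lam Omega (fun x => a l x * w l x)) /\
      forall phi, test_function Omega phi -> forall k,
        L u phi 0 k = \sum_(l < m | eqn l == k)
          \int[lam]_(x in Omega) (a l x * w l x * partials (beta l) phi x).

(* The operator depends only on the functions near the boundary of A; it may be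
   nonlocal along that boundary. *)
Definition boundary_operator (A : set Rd) (G : Type) (B : H -> G) :=
  forall (U : set Rd) (u v : H), open U -> frontier A `<=` U ->
    ae_eq lam (Omega `&` U) (fn u) (fn v) -> B u = B v.

(* Same as above, for functions that are only given outside of A. *)
Definition exterior_boundary_operator (A : set Rd) (G : Type) (B : H -> G) :=
  forall (U : set Rd) (u v : H), open U -> frontier A `<=` U ->
    ae_eq lam ((Omega `\` closure A) `&` U) (fn u) (fn v) -> B u = B v.

(* No compact subset of Omega is seen: the condition bears on the boundary of
   Omega and/or on the behavior at infinity. *)
Definition outer_operator (G : Type) (B : H -> G) :=
  forall (K : set Rd) (u v : H), compact K -> K `<=` Omega ->
    ae_eq lam (Omega `\` K) (fn u) (fn v) -> B u = B v.

End function_space.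

Section problems.
Context {R : realType} {d p N : nat} {H : completeNormedModType R}.
Local Notation Rd := 'rV[R]_d.
Context {G X : 'I_N -> lmodType R} {G0 : lmodType R}.
Variables (Omega : set Rd) (O : 'I_N -> set Rd).
Variable L : {linear H -> ((Rd -> R) -> 'rV[R]_p)}.
Variable B : forall j, {linear H -> G j}.
Variable B0 : {linear H -> G0}.
Variable tau : forall j, {linear H -> X j}.

Definition exterior : set Rd := Omega `\` \bigcup_j closure (O j).

(* The solution is sought among the restrictions to the exterior of the
   objects of the elements of H. *)
Definition bvp (f : (Rd -> R) -> 'rV[R]_p) (b : forall j, G j) (u : H) :=
  [/\ eq_distr_in exterior (L u) f, (forall j, B j u = b j) & B0 u = 0].

Definition single_object_problem (i : 'I_N) (u w : H) :=
  [/\ eq_distr_in (Omega `\` closure (O i)) (L w) (L u), B i w = 0, B0 w = 0,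
      eq_distr_in (O i) (L w) 0 & tau i w = 0].

Definition multiple_object_problem (u w : H) :=
  [/\ eq_distr_in exterior (L w) (L u), (forall j, B j w = 0), B0 w = 0,
      eq_distr_in (\bigcup_j O j) (L w) 0 & forall j, tau j w = 0].

End problems.

Section solution.
Context {R : realType} {H : completeNormedModType R}.

Definition solution_operator (pb : H -> H -> Prop) (u : H) : H := get (pb u).

Definition well_posed (pb : H -> H -> Prop) :=
  (forall u, exists! w, pb u w) /\ continuous (solution_operator pb).

Definition complementary (P : H -> H) (u : H) : H := u - P u.

(* r k i is the reflection u_i^(k); only k >= 1 is meaningful. *)
Definition reflections (N : nat) (PV : 'I_N -> H -> H) (g u0 : H)
    (r : nat -> 'I_N -> H) :=
  (forall i, r 1%N i =
     - PV i (u0 + \sum_(j < N | (j < i)%N) r 1%N j - g)) /\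
  (forall k i, (1 <= k)%N -> r k.+1 i =
     - PV i (\sum_(j < N | (j < i)%N) r k.+1 j
             + \sum_(j < N | (i < j)%N) r k j)).

Definition approximations (N : nat) (u0 : H) (r : nat -> 'I_N -> H)
    (u : nat -> H) :=
  u 0%N = u0 /\ forall k, u k.+1 = u k + \sum_(i < N) r k.+1 i.

End solution.

(* Main.v *)
(* The errors u^(k) - g are the iterates of T = P_{M_N} ... P_{M_1} starting
   from u^(0) - g. Since ||x - T x||^2 <= C (||x||^2 - ||T x||^2), the iterates
   T^k x are asymptotically regular, and the parallelogram law applied to nearly
   minimal elements of x + ran(id - T) makes them Cauchy; the limit z is fixed by
   T, hence by every P_{M_i}. A common fixed point of the P_{M_i} solves the
   multiple-object problem with itself as data, because a test function on the
   disjoint union of the O_j is the sum of its restrictions to the O_j. Moreover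
   P_M P_{M_i} = P_M, as both sides solve the same problem, so that
   P_M x = P_M T^k x -> P_M z = z. *)
Require Import Defs.
From mathcomp Require Import all_boot all_order all_algebra.
From mathcomp Require Import sesquilinear.
From mathcomp Require Import all_classical all_reals all_analysis.
From mathcomp Require Import lra.

Import Order.TTheory GRing.Theory Num.Theory.
Import numFieldNormedType.Exports.

Local Open Scope classical_set_scope.
Local Open Scope ring_scope.

(** * Strong convergence of the iterates of a product of orthogonal projections *)

Section cyclic_projections.
Context {R : realType} {H : completeNormedModType R}.
Variable dot : {dot H for (idfun : R -> R)}.
Hypothesis dotE : hilbert_norm dot.
Implicit Types (x y z w : H) (T P : H -> H).

Lemma dot_sym x y : dot x y = dot y x.
Proof. by rewrite hermC expr0 mul1r. Qed.

Lemma sqr_normD x y : `|x + y| ^+ 2 = `|x| ^+ 2 + `|y| ^+ 2 + dot x y *+ 2.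
Proof.
have dotDl a b c : dot (a + b) c = dot a c + dot b c by exact: linearDl.
have dotDr a b c : dot a (b + c) = dot a b + dot a c by exact: linearDr.
rewrite !dotE dotDl !dotDr (dot_sym y x); lra.
Qed.

Lemma sqr_normB x y : `|x - y| ^+ 2 = `|x| ^+ 2 + `|y| ^+ 2 - dot x y *+ 2.
Proof. by rewrite sqr_normD normrN linearNr mulNrn. Qed.

(* Orthogonal projections satisfy this with C = 1; letting C vary makes the
   condition stable under composition. *)
Definition firm (C : R) T := forall x,
  `|x - T x| ^+ 2 <= C * (`|x| ^+ 2 - `|T x| ^+ 2).

Lemma firm_contraction C T x : 0 < C -> firm C T -> `|T x| <= `|x|.
Proof.
move=> C0 /(_ x) TC; rewrite -(@ler_pXn2r _ 2) ?nnegrE// -subr_ge0.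
by rewrite -(pmulr_rge0 _ C0); exact: le_trans TC.
Qed.

(** The displacement [x - P (T x)] is the sum of those of [T] and of [P], and the drops in squared
    norm add up; the factor 2 comes from [|a + b|^2 <= 2 (|a|^2 + |b|^2)]. *)
Lemma firm_comp C D T P : 0 < C -> 0 < D -> firm C T -> firm D P ->
  firm (2 * (C + D)) (P \o T).
Proof.
move=> C0 D0 TC PD x /=.
have Tx : 0 <= `|x| ^+ 2 - `|T x| ^+ 2.
  by rewrite -(pmulr_rge0 _ C0); exact: le_trans (TC x).
have PTx : 0 <= `|T x| ^+ 2 - `|P (T x)| ^+ 2.
  by rewrite -(pmulr_rge0 _ D0); exact: le_trans (PD (T x)).
have le2 (a b : H) : `|a + b| ^+ 2 <= 2 * (`|a| ^+ 2 + `|b| ^+ 2).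
  by have := sqr_ge0 `|a - b|; rewrite sqr_normB sqr_normD; lra.
have := le2 (x - T x) (T x - P (T x)); rewrite addrA subrK.
move=> /le_trans; apply; rewrite -mulrA ler_pM2l//.
have {}TC := TC x; have {}PD := PD (T x).
apply: (le_trans (lerD TC PD)).
move: Tx PTx; rewrite -[X in (C + D) * X](subrKA (`|T x| ^+ 2)).
set a := `|x| ^+ 2 - _; set b := `|T x| ^+ 2 - _ => Tx PTx.
have := mulr_ge0 (ltW C0) PTx; have := mulr_ge0 (ltW D0) Tx; lra.
Qed.

(** The nonincreasing sequence [|T^k x|^2] converges, so its successive drops tend to 0; up to the
    factor [C] they dominate the squared displacements. *)
Lemma firm_asymptotically_regular C T x : 0 < C -> firm C T ->
  `|iter k T x - iter k.+1 T x| @[k --> \oo] --> 0.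
Proof.
move=> C0 TC; pose a k := `|iter k T x| ^+ 2.
have cva : cvgn a.
  apply: nonincreasing_is_cvgn; last by exists 0 => _ [k _ <-]; exact: sqr_ge0.
  apply/nonincreasing_seqP => k; rewrite /a iterS ler_pXn2r ?nnegrE//.
  exact: firm_contraction TC.
have a0 : C * (a k - a k.+1) @[k --> \oo] --> 0.
  rewrite -(mulr0 C) -(subrr (limn a)); apply: cvgMr; apply: cvgB => //.
  by rewrite (cvg_shiftS a).
have sq0 : `|iter k T x - iter k.+1 T x| ^+ 2 @[k --> \oo] --> 0.
  apply: (squeeze_cvgr _ (cvg_cst _) a0).
  by near=> k; rewrite sqr_ge0 /=; exact: TC.
have := cvg_comp _ _ sq0 (@sqrt_continuous R 0).
rewrite sqrtr0; apply: cvg_trans; apply: near_eq_cvg; near=> k.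
by rewrite /= sqrtr_sqr normr_id.
Unshelve. all: by end_near. Qed.

(* The iterates of a nearly minimal element z of x + ran(id - T) stay close to
   z by the parallelogram law, and T^k x - T^k z tends to 0. *)
Lemma firm_iter_cvg C T x : 0 < C -> linear T -> firm C T ->
  exists2 z, T z = z & iter k T x @[k --> \oo] --> z.
Proof.
move=> C0 linT TC.
have TD u v : T (u + v) = T u + T v by rewrite -[u]scale1r linT !scale1r.
have TZ a u : T (a *: u) = a *: T u.
  have T0 : T 0 = 0 by apply: (addIr (T 0)); rewrite -TD !add0r.
  by rewrite -[a *: u]addr0 linT T0 addr0.
have TB u v : T (u - v) = T u - T v by rewrite TD -scaleN1r TZ scaleN1r.
have itD k u v : iter k T (u + v) = iter k T u + iter k T v.
  by elim: k => //= k ->; rewrite TD.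
have itB k u v : iter k T (u - v) = iter k T u - iter k T v.
  by elim: k => //= k ->; rewrite TB.
have Tle := firm_contraction _ _ _ C0 TC.
have itle k u : `|iter k T u| <= `|u|.
  by elim: k => //= k; apply: le_trans; exact: Tle.
pose S := [set x - (w - T w) | w in setT].
pose E := [set `|y| ^+ 2 | y in S].
have infE : has_inf E.
  split; first by exists (`|x - (0 - T 0)| ^+ 2), (x - (0 - T 0)) => //; exists 0.
  by exists 0 => _ [y _ <-]; exact: sqr_ge0.
(* If [y = x - (w - T w)], then [T y] has the same form with [x + T w] in place of [w], because
   [T x = x - (x - T x)]. *)
have ST k y : S y -> S (iter k T y).
  move=> Sy; elim: k => //= k [w _ <-]; exists (x + T w) => //.
  rewrite !TB TD [in LHS]opprB [in LHS]opprD addrACA (addrCA x (T x - x)) subrKA.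
  by rewrite opprB.
have Smid y y' : S y -> S y' -> S (2^-1 *: (y + y')).
  move=> [w _ <-] [w' _ <-]; exists (2^-1 *: (w + w')) => //.
  rewrite TZ -scalerBr TD opprD addrACA [in RHS]addrACA -opprD scalerBr.
  by rewrite -[x + x]mulr2n -(scaler_nat 2 x) scalerA mulVf// scale1r.
have cauT : cauchy (iter k T x @[k --> \oo]).
  apply: cauchy_exP => e e0.
  (* The parallelogram law will give [|z - T^k z|^2 <= 4 (|z|^2 - inf E)], which this tolerance
     keeps below [(e / 2)^2]. *)
  have e4 : 0 < (e / 4) ^+ 2 by rewrite exprn_gt0// divr_gt0.
  have [_ [z Sz <-] zE] := inf_adherent e4 infE.
  exists z; case: (Sz) => w _ zw.
  have zk k : `|z - iter k T z| <= e / 2.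
    have : inf E <= `|2^-1 *: (z + iter k T z)| ^+ 2.
      apply: ge_inf; first by case: infE.
      by exists (2^-1 *: (z + iter k T z)) => //; apply: Smid => //; exact: ST.
    rewrite normrZ exprMn sqr_normD => iE.
    have le : `|iter k T z| ^+ 2 <= `|z| ^+ 2 by rewrite ler_pXn2r ?nnegrE.
    have e2 : 0 <= e / 2 by rewrite divr_ge0// ltW.
    rewrite -(@ler_pXn2r _ 2) ?nnegrE// sqr_normB.
    move: iE; rewrite ger0_norm ?invr_ge0//.
    set nz := `|z| ^+ 2 in zE le *.
    by move: zE; rewrite !expr2; lra.
  have : \forall k \near \oo, `|iter k T w - iter k.+1 T w| < e / 2.
    have := firm_asymptotically_regular _ _ w C0 TC.
    move=> /cvgr_lt; apply; exact: divr_gt0.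
  apply: filterS => k we; rewrite /= -ball_normE /=.
  (* Since [x = z + (w - T w)], [T^k x] differs from [T^k z] by a displacement of the orbit of [w],
     which is eventually small. *)
  have -> : z - iter k T x = (z - iter k T z) - (iter k T w - iter k.+1 T w).
    have -> : x = z + (w - T w) by rewrite -zw subrK.
    by rewrite itD itB -iterSr opprD addrA.
  rewrite [e]splitr; apply: le_lt_trans (ler_normB _ _) _.
  exact: ler_ltD.
have /cauchy_cvgP/cvg_ex[z zP] := cauT; exists z => //.
have TzP : iter k.+1 T x @[k --> \oo] --> z.
  by rewrite (cvg_shiftS (fun k => iter k T x)).
(* [T] is nonexpansive, hence continuous, so the shifted iterates also tend to [T z]. *)
suff TzT : iter k.+1 T x @[k --> \oo] --> T z.
  exact: cvg_unique TzT TzP.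
apply/cvgrPdist_lt => e e0.
near=> k; rewrite /= -TB; apply: le_lt_trans (Tle _) _; near: k.
exact: cvgr_dist_lt zP _ e0.
Unshelve. all: by end_near. Qed.

(** Indexing by [nat] permits recursion on the number of factors; [P 0] acts first, as in the
    sequential form. *)
Fixpoint sweep (P : nat -> H -> H) n x :=
  if n is n'.+1 then P n' (sweep P n' x) else x.

Section sweep.
Variable P : nat -> H -> H.
Hypothesis P_linear : forall i, linear (P i).
Hypothesis P_firm : forall i, firm 1 (P i).

Lemma sweep_linear n : linear (sweep P n).
Proof. by elim: n => //= n IHn a x y; rewrite IHn P_linear. Qed.

Lemma sweep_firm n : exists2 C, 0 < C & firm C (sweep P n).
Proof.
elim: n => [|n [C C0 IHn]].
  by exists 1 => // x /=; rewrite !subrr normr0 expr0n mulr0.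
exists (2 * (C + 1)); last exact: firm_comp IHn (P_firm n).
by rewrite mulr_gt0// addr_gt0.
Qed.

(** No factor increases the norm, so a fixed point of the product keeps its norm at every stage;
    firmness turns equal norms into zero displacement. *)
Lemma sweep_fixed n z : sweep P n z = z -> forall i, (i < n)%N -> P i z = z.
Proof.
elim: n => //= n IHn Pz i.
have [C C0 sF] := sweep_firm n.
have sz : sweep P n z = z.
  have szz : `|z| <= `|sweep P n z|.
    by rewrite -{1}Pz; exact: firm_contraction ltr01 (P_firm n).
  have : `|z - sweep P n z| ^+ 2 <= 0.
    by apply: le_trans (sF z) _; rewrite pmulr_rle0// subr_le0 ler_pXn2r ?nnegrE.
  rewrite le_eqVlt ltNge sqr_ge0 orbF sqrf_eq0 normr_eq0 subr_eq0.
  by move=> /eqP <-.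
rewrite ltnS leq_eqVlt => /orP[/eqP ->|]; last exact: IHn.
by rewrite sz in Pz.
Qed.

Lemma sweep_iter_cvg n x :
  exists2 z, (forall i, (i < n)%N -> P i z = z) &
    iter k (sweep P n) x @[k --> \oo] --> z.
Proof.
have [C C0 sF] := sweep_firm n.
have [z Tz zP] := firm_iter_cvg _ _ x C0 (sweep_linear n) sF.
by exists z => //; exact: sweep_fixed.
Qed.
End sweep.

(** By Pythagoras, firmness even holds with equality. *)
Lemma orthogonal_projection_firm P :
  orthogonal_projection dot (complementary P) -> linear P /\ firm 1 P.
Proof.
move=> [linP _ orthP].
have PE x : P x = x - complementary P x by rewrite /complementary opprB addrC subrK.
split=> [a x y|x].
  by rewrite !PE linP opprD addrACA -scalerBr.
have := orthP x x; rewrite -PE => xP.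
have := sqr_normD (complementary P x) (P x); rewrite xP /complementary subrK.
by move=> ->; rewrite mul1r mul0rn addr0 addrK.
Qed.

End cyclic_projections.

(** * Distributions vanishing on disjoint open sets vanish on their union *)

Section smooth_restriction.
Context {R : realType} {d : nat}.
Implicit Types (f g phi : 'rV[R]_d -> R) (A C : set 'rV[R]_d).

Lemma near_eq_partials f g (x : 'rV[R]_d) s :
  (\near x, f x = g x) -> \near x, partials s f x = partials s g x.
Proof.
move=> fg; elim: s => [//|i s IHs] /=.
near=> y; apply: near_eq_derive; near: y.
exact: near_join IHs.
Unshelve. all: by end_near. Qed.

Lemma smooth_near f :
  (forall x : 'rV[R]_d, exists2 g, smooth g & \near x, f x = g x) -> smooth f.
Proof.
move=> fP s; split=> [x|x i]; have [g gs fg] := fP x;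
  have [cg dg] := gs s; have fgs := near_eq_partials _ _ _ s fg.
- have fgx := nbhs_singleton fgs.
  rewrite /continuous_at fgx; apply: cvg_trans (cg x).
  by apply: (@near_eq_cvg _ _ (nbhs x)); apply: filterS fgs => y ->.
- by apply: near_eq_derivable (dg x i); apply: filterS fgs => y ->.
Qed.

Lemma smooth0 : smooth (cst 0 : 'rV[R]_d -> R).
Proof.
move=> s; have -> : partials s (cst 0 : 'rV[R]_d -> R) = cst 0.
  elim: s => [//|i s /= ->]; apply/funext => x; exact: derive_cst.
by split=> [|x i]; [exact: cst_continuous | exact: derivable_cst].
Qed.

Lemma supp_restrict phi A : supp (phi \_ A) `<=` supp phi.
Proof.
apply: closure_subset => x /=; rewrite patchE; case: ifP => // _.
by rewrite eqxx.
Qed.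

(** Smoothness is local: the extension by zero agrees with [phi] near points of [A] and with 0 near
    points of [C]; any other point is off the closed support of [phi]. Vanishing near [C] also keeps
    the new support inside [A]. *)
Lemma test_function_restrict phi A C : open A -> open C -> A `&` C = set0 ->
  test_function (A `|` C) phi -> test_function A (phi \_ A).
Proof.
move=> oA oC AC [phis phic phiAC].
have off x : C x -> \near x, (phi \_ A) x = 0.
  move=> Cx; have : \near x, C x by exact: open_nbhs_nbhs.
  apply: filterS => y Cy; rewrite patchE memNset // => Ay.
  by have : set0 y by rewrite -AC.
split.
- apply: smooth_near => x.
  have [Ax|nAx] := pselect (A x).
    exists phi => //; have : \near x, A x by exact: open_nbhs_nbhs.
    by apply: filterS => y Ay; rewrite patchE mem_set.
  exists (cst 0); first exact: smooth0.
  have [Cx|nCx] := pselect (C x); first exact: off.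
  have : \near x, (~` supp phi) x.
    apply: open_nbhs_nbhs; split; first exact/closed_openC/closed_closure.
    by move=> /phiAC[].
  apply: filterS => y phiy; rewrite patchE; case: ifP => // _.
  by apply: contrapT => /eqP phiy0; apply: phiy; exact: subset_closure.
- by apply: subclosed_compact phic (@supp_restrict _ _); exact: closed_closure.
- move=> x sx; have [//|Cx] := phiAC x (supp_restrict _ _ _ sx).
  by have [y [/= /eqP]] := sx _ (off _ Cx).
Qed.

Lemma test_functionW phi A C : A `<=` C -> test_function A phi ->
  test_function C phi.
Proof. by move=> AC [? ? /subset_trans phiA]; split => //; exact: phiA. Qed.

Lemma distribution_setU p (Omega A C : set 'rV[R]_d)
    (T : ('rV[R]_d -> R) -> 'rV[R]_p) :
  is_distribution Omega T -> open A -> open C -> A `&` C = set0 ->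
  A `|` C `<=` Omega ->
  eq_distr_in A T 0 -> eq_distr_in C T 0 -> eq_distr_in (A `|` C) T 0.
Proof.
move=> [linT _] oA oC AC; rewrite subUset => -[AO CO] TA TC phi phiAC.
have phiA := test_function_restrict _ _ _ oA oC AC phiAC.
have phiC : test_function C (phi \_ C).
  by apply: (test_function_restrict _ C A); rewrite 1?setIC 1?setUC.
have -> : phi = 1 *: (phi \_ A) + phi \_ C.
  apply/funext => x; rewrite /= !fctE scale1r !patchE.
  have [Ax|nAx] := pselect (A x); have [Cx|nCx] := pselect (C x).
  - by have : set0 x by rewrite -AC.
  - by rewrite mem_set// memNset// addr0.
  - by rewrite memNset// mem_set// add0r.
  - rewrite !memNset// addr0; apply: contrapT => /eqP phix.
    by have [_ _ /(_ x)[]] := phiAC; first exact: subset_closure.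
rewrite linT; [|exact: test_functionW phiA|exact: test_functionW phiC].
by rewrite TA// TC// scaler0 addr0.
Qed.

Lemma distribution_set0 p (Omega : set 'rV[R]_d)
    (T : ('rV[R]_d -> R) -> 'rV[R]_p) :
  is_distribution Omega T -> eq_distr_in set0 T 0.
Proof.
move=> [linT _] phi phi0; have phiO := test_functionW _ _ _ (@sub0set _ Omega) phi0.
have phiE : phi = 0.
  apply/funext => x; apply: contrapT => /eqP phix.
  by have [_ _ /(_ x)[]] := phi0; exact: subset_closure.
have := linT 1 phi phi phiO phiO; rewrite phiE scale1r addr0 scale1r.
by move=> /eqP; rewrite -subr_eq0 opprD addrA subrr sub0r oppr_eq0 => /eqP.
Qed.

Lemma distribution_bigcup p N (Omega : set 'rV[R]_d)
    (O : 'I_N -> set 'rV[R]_d) (T : ('rV[R]_d -> R) -> 'rV[R]_p) :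
  is_distribution Omega T -> (forall j, open (O j)) ->
  (forall i j, i != j -> O i `&` O j = set0) -> (forall j, O j `<=` Omega) ->
  (forall j, eq_distr_in (O j) T 0) -> eq_distr_in (\bigcup_j O j) T 0.
Proof.
move=> dT oO disj OO TO.
suff TOn n : eq_distr_in (\bigcup_(i in [set i : 'I_N | (i < n)%N]) O i) T 0.
  rewrite (_ : [set: 'I_N] = [set i : 'I_N | (i < N)%N])//.
  by apply/seteqP; split => // i _; exact: ltn_ord.
elim: n => [|n IHn].
  rewrite [X in bigcup X _](_ : _ = set0); last by apply/seteqP; split.
  by rewrite bigcup_set0; exact: distribution_set0 dT.
(* From [n = N] on, raising the bound adds no index. *)
have [nN|Nn] := ltnP n N; last first.
  rewrite [X in bigcup X _](_ : _ = [set i : 'I_N | (i < n)%N])//.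
  by apply/seteqP; split => i _ /=; [exact: leq_trans Nn|rewrite ltnS ltnW//];
    exact: leq_trans Nn.
rewrite [X in bigcup X _](_ : _ = [set i : 'I_N | (i < n)%N] `|` [set Ordinal nN]).
  rewrite bigcup_setU bigcup_set1; apply: distribution_setU dT _ _ _ _ IHn _ => //.
  - exact: bigcup_open.
  - rewrite setI_bigcupl; apply: bigcup0 => i /= iltn; apply: disj.
    by rewrite -val_eqE/= ltn_eqF.
  - by rewrite subUset; split => //; exact: bigcup_sub.
apply/seteqP; split => i /=.
  by rewrite ltnS leq_eqVlt => /orP[/eqP iE|]; [right; exact: val_inj|left].
by move=> [/ltnW|->] //=.
Qed.
End smooth_restriction.

(** * The method of reflections as cyclic projections of the error *)

(* With e k n := u k - g + sum_(j < n) r k.+1 j, each reflection is one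
   projection step e k i.+1 = P i (e k i). *)
Lemma reflections_sweep {R : realType} {H : completeNormedModType R} (N : nat)
    (PV_ : 'I_N -> H -> H) (g u0 : H) r u (P : nat -> H -> H) :
  (forall i, linear (PV_ i)) -> (forall i x, PV_ i (PV_ i x) = PV_ i x) ->
  reflections PV_ g u0 r -> approximations u0 r u ->
  (forall i : 'I_N, P i =1 complementary (PV_ i)) ->
  forall k, u k - g = iter k (sweep P N) (u0 - g).
Proof.
move=> linPV idemPV [r1 rS] [u0E uS] PE.
have PVD i x y : PV_ i (x + y) = PV_ i x + PV_ i y.
  by rewrite -[x]scale1r linPV !scale1r.
have PV_P (i : 'I_N) x : PV_ i (P i x) = 0.
  apply: (addIr (PV_ i x)); rewrite add0r -{1}(idemPV i x) -PVD PE.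
  by rewrite /complementary subrK.
pose e k n := u k - g + \sum_(j < N | (j < n)%N) r k.+1 j.
have e0 k : e k 0%N = u k - g by rewrite /e big_pred0// addr0.
have eN k : e k N = u k.+1 - g.
  rewrite /e uS addrAC; congr (_ + _ - _).
  by apply: eq_bigl => j; rewrite ltn_ord.
have eS k (i : 'I_N) : e k i.+1 = e k i + r k.+1 i.
  rewrite /e (bigD1 i) ?ltnS//= -[RHS]addrA [r _ i + _]addrC; congr (_ + (_ + _)).
  by apply: eq_bigl => j; rewrite ltnS ltn_neqAle andbC.
have eP k (i : 'I_N) : e k i.+1 = P i (e k i).
  rewrite eS PE /complementary; congr (_ + _).
  elim: k i => [|k IHk] i; first by rewrite r1 /e u0E addrAC.
  rewrite rS//; congr (- _).
  (* Going from [e k i.+1] to [e k.+1 i] adds the old reflections with [j > i] and the new ones with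
     [j < i]; the induction hypothesis makes [e k i.+1] a value of [P i], which [PV_ i] kills. *)
  have -> : e k.+1 i = \sum_(j < N | (j < i)%N) r k.+2 j +
      \sum_(j < N | (i < j)%N) r k.+1 j + P i (e k i).
    have -> : P i (e k i) = e k i.+1 by rewrite eS PE /complementary -IHk.
    rewrite /e uS [LHS]addrC -[RHS]addrA; congr (_ + _).
    rewrite addrAC (bigID (fun j : 'I_N => (j < i.+1)%N))/= [RHS]addrC -[RHS]addrA.
    by congr (_ + (_ + _)); apply: eq_bigl => j; rewrite -leqNgt.
  by rewrite [RHS]PVD PV_P addr0.
elim=> [|k IHk]; first by rewrite u0E.
rewrite iterS -IHk -eN -e0.
suff eSw n : (n <= N)%N -> e k n = sweep P n (e k 0%N) by exact: eSw.
elim: n => //= n IHn nN; rewrite -IHn; last exact: ltnW.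
exact: eP (Ordinal nN).
Qed.

(** * Projections as solution operators, and identification of the limit *)

Lemma well_posedP {R : realType} {H : completeNormedModType R}
    (pb : H -> H -> Prop) u w :
  well_posed pb -> pb u w <-> w = solution_operator pb u.
Proof.
move=> [pbU _]; have [v [pbv vU]] := pbU u.
have pbs : pb u (solution_operator pb u) by apply: getPex; exists v.
by split=> [pbw|->//]; rewrite -(vU _ pbw) -(vU _ pbs).
Qed.

Theorem theorem4p1 (R : realType) (d q p N : nat)
  (d_gt0 : (0 < d)%N) (N_gt0 : (0 < N)%N)
  (lam : {measure set (borel R d) -> \bar R})
  (lam_lebesgue : is_lebesgue_measure lam)
  (Omega : set 'rV[R]_d) (O : 'I_N -> set 'rV[R]_d)
  (Omega_open : open Omega)
  (Omega_simply_connected : simply_connected R Omega)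
  (Omega_regular : interior (closure Omega) = Omega)
  (O_open : forall j, open (O j))
  (O_sub : forall j, O j `<=` Omega)
  (O_bounded : forall j, bounded_set (O j))
  (O_simply_connected : forall j, simply_connected R (O j))
  (O_smooth : forall j, smooth_boundary (O j))
  (O_disjoint : forall i j, i != j -> closure (O i) `&` closure (O j) = set0)
  (H : completeNormedModType R) (dot : {dot H for (idfun : R -> R)})
  (H_hilbert : hilbert_norm dot)
  (fn : H -> 'rV[R]_d -> 'rV[R]_q)
  (H_functions : function_space lam Omega fn)
  (L : {linear H -> (('rV[R]_d -> R) -> 'rV[R]_p)})
  (L_diff : differential_operator lam Omega fn L)
  (G : 'I_N -> lmodType R) (B : forall j, {linear H -> G j})
  (B_boundary : forall j, exterior_boundary_operator lam Omega fn (O j) (B j))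
  (G0 : lmodType R) (B0 : {linear H -> G0})
  (B0_outer : outer_operator lam Omega fn B0)
  (X : 'I_N -> lmodType R) (tau : forall j, {linear H -> X j})
  (tau_boundary : forall j, boundary_operator lam Omega fn (O j) (tau j))
  (f : ('rV[R]_d -> R) -> 'rV[R]_p) (f_distr : is_distribution Omega f)
  (b : forall j, G j)
  (bvp_well_posed : exists u, bvp Omega O L B B0 f b u /\
     forall v, bvp Omega O L B B0 f b v ->
       ae_eq lam (exterior Omega O) (fn v) (fn u))
  (g : H) (g_lift : forall j, B j g = b j) (g_outer : B0 g = 0)
  (u0 : H) (u0_eq : eq_distr_in Omega (L u0) f) (u0_outer : B0 u0 = 0)
  (T_well_posed : forall i,
     well_posed (single_object_problem Omega O L B B0 tau i))
  (M_well_posed : well_posed (multiple_object_problem Omega O L B B0 tau))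
  (PM_ : 'I_N -> H -> H)
  (PM_def : PM_ = fun i =>
     solution_operator (single_object_problem Omega O L B B0 tau i))
  (PV_ : 'I_N -> H -> H) (PV_def : PV_ = fun i => complementary (PM_ i))
  (PV_orthogonal : forall i, orthogonal_projection dot (PV_ i))
  (PM : H -> H)
  (PM_multi_def :
     PM = solution_operator (multiple_object_problem Omega O L B B0 tau))
  (PV : H -> H) (PV_multi_def : PV = complementary PM)
  (r : nat -> 'I_N -> H) (r_reflections : reflections PV_ g u0 r)
  (u : nat -> H) (u_approx : approximations u0 r u) :
  let ustar := PV g + PM u0 in
  [/\ bvp Omega O L B B0 f b ustar,
      (forall v, bvp Omega O L B B0 f b v ->
         ae_eq lam (exterior Omega O) (fn v) (fn ustar)) &
      u k @[k --> \oo] --> ustar].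
Proof.
have sop i x w : single_object_problem Omega O L B B0 tau i x w <-> w = PM_ i x.
  by rewrite PM_def; exact: well_posedP.
have mop x w : multiple_object_problem Omega O L B B0 tau x w <-> w = PM x.
  by rewrite PM_multi_def; exact: well_posedP.
have exterior_sub i : exterior Omega O `<=` Omega `\` closure (O i).
  by move=> x [Ox nOx]; split=> // Oix; apply: nOx; exists i.
have exteriorO : exterior Omega O `<=` Omega by move=> x [].
(* By uniqueness, an identity for [PM] reduces to checking that the candidate solves the problem. *)
have PM_B x y : PM (x - y) = PM x - PM y.
  have [xE xB xB0 xO xtau] := (mop x _).2 erefl.
  have [yE yB yB0 yO ytau] := (mop y _).2 erefl.
  apply/esym/mop; split.
  - by move=> phi phiE; rewrite !linearB !fctE xE// yE.
  - by move=> j; rewrite linearB xB yB subrr.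
  - by rewrite linearB xB0 yB0 subrr.
  - by move=> phi phiE; rewrite linearB !fctE xO// yO// subrr.
  - by move=> j; rewrite linearB xtau ytau subrr.
(* The problem sees its datum only through [L] on the exterior, where [PM_ i x] and [x] have the
   same image. *)
have PM_PM_ i x : PM (PM_ i x) = PM x.
  have [xE xB xB0 xO xtau] := (mop x _).2 erefl.
  have [iE _ _ _ _] := (sop i x _).2 erefl.
  apply/esym/mop; split=> // phi phiE.
  by rewrite xE// iE//; exact: test_functionW phiE.
have PM_fixed z : (forall i, PM_ i z = z) -> PM z = z.
  move=> zi; have zs i := (sop i z z).2 (esym (zi i)).
  apply/esym/mop; split=> //.
  - by move=> j; have [] := zs j.
  - by have [] := zs (Ordinal N_gt0).
  - apply: (@distribution_bigcup _ _ _ _ Omega) => //.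
    + by have [] := L_diff.
    + move=> i j /O_disjoint ij0; rewrite -subset0 -ij0.
      by apply: setISS; exact: subset_closure.
    + by move=> j; have [] := zs j.
  - by move=> j; have [] := zs j.
have bvp_ustar : bvp Omega O L B B0 f b (PV g + PM u0).
  have [gE gB gB0 gO gtau] := (mop g _).2 erefl.
  have [uE uB uB0 uO utau] := (mop u0 _).2 erefl.
  (* On the exterior, [L] kills [g - PM g] and sends [PM u0] to [f]; the boundary data come from [g]
     alone. *)
  rewrite PV_multi_def /complementary; split.
  - move=> phi phiE; rewrite linearD linearB !fctE gE// uE// subrr add0r.
    by apply: u0_eq; exact: test_functionW phiE.
  - by move=> j; rewrite linearD linearB gB uB subr0 addr0.
  - by rewrite linearD linearB gB0 uB0 g_outer subr0 addr0.
move=> ustar; split=> //.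
  move=> v vP; have [w [_ wU]] := bvp_well_posed.
  exact: ae_eq_trans (wU _ vP) (ae_eq_sym (wU _ bvp_ustar)).
(* Indices beyond [N] default to the first object, so that every [P n] is a genuine projection. *)
pose P n := PM_ (insubd (Ordinal N_gt0) n).
have PE (i : 'I_N) : P i = PM_ i by rewrite /P valKd.
have PM_firm i : linear (PM_ i) /\ firm 1 (PM_ i).
  by apply: (orthogonal_projection_firm dot); have := PV_orthogonal i; rewrite PV_def.
have [||z zfix zP] := sweep_iter_cvg dot H_hilbert P _ _ N (u0 - g).
- by move=> n; have [] := PM_firm (insubd (Ordinal N_gt0) n).
- by move=> n; have [] := PM_firm (insubd (Ordinal N_gt0) n).
have uE k : u k - g = iter k (sweep P N) (u0 - g).
  apply: reflections_sweep r_reflections u_approx _ k.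
  - by move=> i; have [] := PV_orthogonal i.
  - by move=> i; have [] := PV_orthogonal i.
  - by move=> i x; rewrite PE PV_def /complementary subKr.
have PMz : PM z = z.
  by apply: PM_fixed => i; rewrite -PE; exact: zfix.
have PM_sweep n x : PM (sweep P n x) = PM x by elim: n => //= n; rewrite PM_PM_.
have PM_iter k : PM (iter k (sweep P N) (u0 - g)) = PM (u0 - g).
  by elim: k => //= k; rewrite PM_sweep.
have PM_cont : continuous PM by rewrite PM_multi_def; case: M_well_posed.
(* [PM] is continuous and constant along the iterates, so its value at the limit [z] is
   [PM (u0 - g)]. *)
have zE : z = PM (u0 - g).
  rewrite -PMz; have := cvg_comp _ _ zP (PM_cont z).
  rewrite (_ : PM \o _ = cst (PM (u0 - g))); last exact/funext.
  by move=> /cvg_unique; apply => //; exact: cvg_cst.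
have -> : ustar = z + g.
  by rewrite zE PM_B /ustar PV_multi_def /complementary addrC addrA addrAC.
have -> : u = (fun k => iter k (sweep P N) (u0 - g) + g).
  by apply/funext => k; rewrite -uE subrK.
by apply: cvgD zP _; exact: cvg_cst.
Qed.
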